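(* Let $(Y,X,D)$ be random with $Y\in\mathbb R$, $X\in\mathbb R$ (i.e. $p=1$), $D\in\{0,1\}$, and consider the linear regression model $Y=\alpha+\beta D+s(X)'\gamma+E$. Let $Z=(1,D,s(X)')'$, and suppose that $\mathbf E[\|Z\|^2]$ and $\mathbf E[\|ZE\|]$ are finite, $\mathbf E[ZZ']$ is positive definite, and $\mathbf E[ZE]=\mathbf 0$. Suppose also that $f(\cdot,0)-l_\theta^s(\cdot,0)$ is continuous and bounded on $\mathcal X^0\cup\mathcal X^1$. Let $\mathcal H$ be the class of all continuous and bounded functions $h:\mathbb R\to\mathbb R$ with $h(x)=f(x,0)-l_\theta^s(x,0)$ for every $x\in\mathcal X^0\cup\mathcal X^1$, and define $$m^{\mathrm{KS}}=\inf_{h\in\mathcal H}V_{-\infty}^{\infty}[h],\qquad c^{\mathrm{KS}}=\sup_{x\in\mathbb R}|G^1(x)-G^0(x)|,$$ where $V_{-\infty}^\infty[h]\in[0,\infty]$ is the total variation of $h$ on $\mathbb R$ and $G^d(x)$ is the value at $x$ of the distribution function of $G^d$. Then $$|\beta-\tau|\le m^{\mathrm{KS}}c^{\mathrm{KS}}.$$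
   Context: For $d\in\{0,1\}$, $G^d$ is the conditional distribution of $X$ given $D=d$, with (closed) support $\mathcal X^d\subseteq\mathbb R$. $F$ is the conditional distribution of $Y$ given $(X,D)$, regarded as a given kernel defined for $(x,d)\in(\mathcal X^0\cup\mathcal X^1)\times\{0,1\}$, and $f(x,d)=\mathbf E[Y|X=x,D=d]$ is its mean. The parameter of interest is $$\tau=\mathbf E[Y|D=1]-\mathbf E[\mathbf E[Y|X,D=0]|D=1]=\mathbf E[Y|D=1]-\int f(x,0)\,G^1(\mathrm dx),$$ assumed to be well defined (i.e. $f(\cdot,0)$ is $G^1$-integrable). $s$ is a measurable map from $\mathbb R$ to a finite-dimensional Euclidean space, $\theta=(\alpha,\beta,\gamma')'$, and $l_\theta^s(x,d)=\alpha+\beta d+s(x)'\gamma$. Convention: $0\cdot\infty=0$. *)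

(* Defs.v *)
From HB Require Import structures.
From mathcomp Require Import all_boot all_order all_algebra.
From mathcomp Require Import all_classical all_reals all_analysis.
Import Order.TTheory GRing.Theory Num.Theory.
Import numFieldNormedType.Exports.

Set Implicit Arguments.
Unset Strict Implicit.
Unset Printing Implicit Defensive.

Local Open Scope classical_set_scope.
Local Open Scope ring_scope.

Section linear_algebra.
Context {R : realType}.

(* The library's norm on matrices is the max norm. *)
Definition eucl_norm n (v : 'cV[R]_n) : R := Num.sqrt (\sum_i v i ord0 ^+ 2).

Definition posdefmx n (A : 'M[R]_n) : Prop :=
  A^T = A /\ forall v : 'cV[R]_n, v != 0 -> 0 < (v^T *m A *m v) ord0 ord0.

(* Borel measurability of a map into a Euclidean space, which is the same as
   measurability of each coordinate. *)
Definition measurable_vec k (s : R -> 'cV[R]_k) : Prop :=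
  forall j, measurable_fun [set: R] (fun x => s x j ord0).

Definition lin_reg k (s : R -> 'cV[R]_k) (alpha beta : R) (gamma : 'cV[R]_k)
    (x : R) (d : bool) : R :=
  alpha + beta * d%:R + ((s x)^T *m gamma) ord0 ord0.

Definition regressor k (s : R -> 'cV[R]_k) (x : R) (d : bool) :
    'cV[R]_(1 + 1 + k) :=
  col_mx (col_mx 1%:M (d%:R)%:M) (s x).

End linear_algebra.

Section conditioning.
Context {d : measure_display} {Omega : measurableType d} {R : realType}.
Variables (P : probability Omega R) (X Y : {RV P >-> R}) (D : {RV P >-> bool}).

Lemma measurable_event (b : bool) : measurable (D @^-1` [set b]).
Proof. by rewrite -[X in measurable X]setTI; exact: measurable_funP. Qed.

(* P(. | D = b); normalization falls back on P itself when P(D = b) = 0. *)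
Definition cond_prob (b : bool) : probability Omega R :=
  mnormalize (mrestr P (measurable_event b)) P.

Definition cond_law (b : bool) : probability R R :=
  distribution (cond_prob b) X.

(* Regular conditional distribution of Y given (X, D): F(X, D)(B) is a version of
   P(Y \in B | X, D). A kernel given only on S * {0, 1}, with S the union of the
   closed supports of the two conditional laws of X, is encoded by any measurable
   extension: when both values of D have positive probability, (X, D) lies in
   S * {0, 1} almost surely, so this condition does not depend on the extension. *)
Definition is_cond_dist (F : R.-pker (R * bool) ~> R) : Prop :=
  forall (A : set (R * bool)) (B : set R), measurable A -> measurable B ->
    (\int[P]_(w in [set w | A (X w, D w)]) F (X w, D w) B =
     P ([set w | A (X w, D w)] `&` Y @^-1` B))%E.

End conditioning.

Section functionals.
Context {R : realType}.

Definition msupport (mu : set R -> \bar R) : set R :=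
  [set x | forall U : set R, open U -> U x -> (0 < mu U)%E].

Definition cond_mean (F : R.-pker (R * bool) ~> R) (x : R) (d : bool) : R :=
  \int[F (x, d)]_y y.

(* Total variation on the whole line: supremum over all compact intervals. *)
Definition line_variation (h : R -> R) : \bar R :=
  ereal_sup [set total_variation ab.1 ab.2 h | ab in [set ab | ab.1 <= ab.2]].

Definition extensions (S : set R) (g : R -> R) : set (R -> R) :=
  [set h | [/\ continuous h, bounded_fun h & forall x, S x -> h x = g x]].

Definition mKS (S : set R) (g : R -> R) : \bar R :=
  ereal_inf [set line_variation h | h in extensions S g].

Definition cKS (G1 G0 : set R -> \bar R) : \bar R :=
  ereal_sup [set `|G1 [set` `]-oo, x]] - G0 [set` `]-oo, x]]|%E | x in [set: R]].

End functionals.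

(* Main.v *)
Require Import Defs.
From HB Require Import structures.
From mathcomp Require Import all_boot all_order all_algebra.
From mathcomp Require Import all_classical all_reals all_analysis.
From mathcomp Require Import measurable_realfun giry ring lra.
Import Order.TTheory GRing.Theory Num.Theory.
Import numFieldNormedType.Exports.
Local Open Scope classical_set_scope.
Local Open Scope ring_scope.

(** Orthogonality of the residual to the constant and to [D] makes its mean
vanish given [D = 0] and given [D = 1] separately. Hence, with
[g x = f(x, 0) - l(x, 0)], the integral of [g] is [beta - tau] under [G^1] and
[0] under [G^0], so that [beta - tau] is the difference of the two integrals of
any [h] extending [g]. Approximating [h] by step functions and summing by parts
bounds this difference by the total variation of [h] times the
Kolmogorov-Smirnov distance. *)

(** * Step functions, and the variation bound for a difference of integrals *)

Section step_approximation.
Context {R : realType}.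
Implicit Types (h : R -> R) (u : nat -> R) (x V c : R).

(* For nondecreasing [u], this is [h (u i)] on ]u (i - 1), u i], [h (u 0)] below
   [u 0] and [h (u m)] above [u m], in the form given by summation by parts. *)
Definition step_approx h u m x : R :=
  h (u m) - \sum_(i < m) (h (u i.+1) - h (u i)) * \1_([set` `]-oo, u i]]) x.

(** A new node changes the function only to the right of [u m]. There all indicators vanish and
    [h (u m.+1)] remains; to the left, the new summand turns [h (u m.+1)] back into [h (u m)]. *)
Lemma step_approxS h u m x : (forall i j, (i <= j)%N -> u i <= u j) ->
  step_approx h u m.+1 x = if x <= u m then step_approx h u m x else h (u m.+1).
Proof.
move=> u_nd; rewrite /step_approx; case: ifPn => [xm|].
  rewrite big_ord_recr/= indicE mem_set/= ?in_itv//= mulr1; ring.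
rewrite -ltNge => mx; rewrite big1 ?subr0// => i _.
rewrite indicE memNset ?mulr0//= in_itv/= => xi.
have := u_nd i m (ltn_ord i).
by rewrite leNgt (lt_le_trans mx xi).
Qed.

Lemma step_approx_bound h u m x C : (forall i j, (i <= j)%N -> u i <= u j) ->
  (forall y, `|h y| <= C) -> `|step_approx h u m x| <= C.
Proof.
move=> u_nd hC; elim: m => [|m IH].
  by rewrite /step_approx big_ord0 subr0.
by rewrite step_approxS//; case: ifP.
Qed.

Lemma step_approx_near h u m x e : (forall i j, (i <= j)%N -> u i <= u j) ->
  (forall i, u i.+1 - u i <= e) -> u 0%N < x -> x <= u m ->
  exists2 y, step_approx h u m x = h y & `|x - y| <= e.
Proof.
move=> u_nd ue ux; elim: m => [|m IH]; first by rewrite leNgt ux.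
move=> xm; rewrite step_approxS//; case: ifPn => [/IH//|].
(* On the last cell ][u m], [u m.+1]] the step function takes the value of [h] at the right
   endpoint. *)
rewrite -ltNge => mx; exists (u m.+1) => //.
by have := ue m; rewrite ler_norml; lra.
Qed.


Let integrable_step (mu : probability R R) a y :
  mu.-integrable setT (EFin \o (fun x => a * (1 - \1_([set` `]-oo, y]]) x))).
Proof.
apply: (@integrableZl _ _ _ mu setT measurableT a
  (EFin \o (cst 1 \- \1_([set` `]-oo, y]])))).
have i1 : mu.-integrable setT (EFin \o \1_([set` `]-oo, y]])).
  exact: integrable_indic.
have i0 : mu.-integrable setT (EFin \o cst 1).
  exact: finite_measure_integrable_cst.
exact: (integrableB measurableT i0 i1).
Qed.

(** The factor is kept as one minus an indicator because its integral is one minus the distribution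
    function at [u m]. *)
Lemma step_approx_recr h u m x : step_approx h u m.+1 x =
  step_approx h u m x +
  (h (u m.+1) - h (u m)) * (1 - \1_([set` `]-oo, u m]]) x).
Proof. by rewrite /step_approx big_ord_recr/=; ring. Qed.

Lemma integrable_step_approx (mu : probability R R) h u m :
  mu.-integrable setT (EFin \o step_approx h u m).
Proof.
elim: m => [|m IH].
  rewrite (_ : step_approx h u 0 = cst (h (u 0%N))).
    exact: finite_measure_integrable_cst.
  by apply/funext => x; rewrite /step_approx big_ord0 subr0.
have -> : EFin \o step_approx h u m.+1 = (EFin \o step_approx h u m) \+
    (EFin \o (fun x =>
      (h (u m.+1) - h (u m)) * (1 - \1_([set` `]-oo, u m]]) x))).
  by apply/funext => x /=; rewrite step_approx_recr EFinD.
by apply: integrableD => //; exact: integrable_step.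
Qed.

Lemma Rintegral_step_approxS (mu : probability R R) h u m :
  \int[mu]_x step_approx h u m.+1 x = \int[mu]_x step_approx h u m x +
  (h (u m.+1) - h (u m)) * (1 - fine (mu [set` `]-oo, u m]])).
Proof.
under eq_Rintegral do rewrite step_approx_recr.
rewrite RintegralD//; [|exact: integrable_step_approx|exact: integrable_step].
have i1 : mu.-integrable setT (EFin \o \1_([set` `]-oo, u m]])).
  exact: integrable_indic.
have i0 : mu.-integrable setT (EFin \o cst 1).
  exact: finite_measure_integrable_cst.
rewrite RintegralZl//; last exact: (integrableB measurableT i0 i1).
have -> : \int[mu]_x (1 - \1_([set` `]-oo, u m]]) x) =
    \int[mu]_x cst 1 x - \int[mu]_x \1_([set` `]-oo, u m]]) x.
  by rewrite -RintegralB.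
rewrite Rintegral_cst//= probability_setT mulr1.
by rewrite [X in _ * (_ - X)]/Rintegral integral_indic// setIT.
Qed.

(** Both measures have mass one, so the constants cancel in the difference of the integrals. Each
    increment of [h] is then weighted by a difference of distribution functions at its left node,
    which is at most [c] in absolute value. *)
Lemma Rintegral_step_approx_diff (mu nu : probability R R) h u m c :
  (forall x, `|fine (mu [set` `]-oo, x]]) - fine (nu [set` `]-oo, x]])| <= c) ->
  `|\int[mu]_x step_approx h u m x - \int[nu]_x step_approx h u m x| <=
  (\sum_(i < m) `|h (u i.+1) - h (u i)|) * c.
Proof.
move=> munu; elim: m => [|m IH].
  rewrite big_ord0 mul0r (_ : step_approx h u 0 = cst (h (u 0%N))); last first.
    by apply/funext => x; rewrite /step_approx big_ord0 subr0.
  by rewrite !Rintegral_cst//= !probability_setT subrr normr0.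
rewrite big_ord_recr/= mulrDl !Rintegral_step_approxS.
set a := Rintegral _ _ _ in IH *; set b := Rintegral _ _ _ in IH *.
rewrite (_ : _ - _ = (a - b) + (h (u m.+1) - h (u m)) *
  (fine (nu [set` `]-oo, u m]]) - fine (mu [set` `]-oo, u m]]))); last by ring.
rewrite (le_trans (ler_normD _ _))// lerD// normrM ler_wpM2l//.
by rewrite distrC.
Qed.

Lemma sum_increments_le_variation h u m :
  (forall i j, (i <= j)%N -> u i <= u j) ->
  ((\sum_(i < m) `|h (u i.+1) - h (u i)|)%:E <=
    total_variation (u 0%N) (u m) h)%E.
Proof.
move=> u_nd; elim: m => [|m IH]; first by rewrite big_ord0 total_variationxx.
rewrite big_ord_recr/= (@total_variationD _ _ _ (u m))//; try exact: u_nd.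
by rewrite EFinD leeD// total_variation_ge// u_nd.
Qed.

(* Dominated convergence for step functions of mesh [1 / (n + 1)] on [-n, n]. *)
Lemma Rintegral_diff_le_variation (mu nu : probability R R) h V c :
  continuous h -> bounded_fun h ->
  (line_variation h <= V%:E)%E ->
  (forall x, `|fine (mu [set` `]-oo, x]]) - fine (nu [set` `]-oo, x]])| <= c) ->
  `|\int[mu]_x h x - \int[nu]_x h x| <= V * c.
Proof.
move=> ch bh; have [M0 [_ /(_ (Num.max M0 0 + 1))]] := bh; move=> + hV munu.
(* Boundedness is available for every constant strictly above [M0], hence the [+ 1]. *)
set M := _ + 1 => hM.
have {}hM y : `|h y| <= M.
  by apply: hM => //; rewrite /M ltr_pwDr// le_max lexx.
pose u (n i : nat) : R := - n%:R + i%:R / n.+1%:R.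
have u_nd n i j : (i <= j)%N -> u n i <= u n j.
  by move=> ij; rewrite lerD2l ler_wpM2r// ?invr_ge0// ler_nat.
(* The number of steps of length [1 / (n + 1)] that lead from [-n] to [n]. *)
pose m (n : nat) := (n.*2 * n.+1)%N.
have um n : u n (m n) = n%:R.
  rewrite /u /m natrM mulfK// -addnn natrD; ring.
pose g n := step_approx h (u n) (m n).
have mh : measurable_fun setT h by exact: continuous_measurable_fun.
have c0 : 0 <= c by apply: le_trans (munu 0).
have cvgI (P : probability R R) :
    \int[P]_x g n x @[n --> \oo] --> \int[P]_x h x.
  apply: fine_cvg; rewrite fineK; last first.
    apply: integrable_fin_num => //.
    apply: measurable_bounded_integrable => //.
    by rewrite -ge0_fin_numE// fin_num_measure.
  have [] // := @dominated_convergence _ _ _ P setT measurableT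
    (fun n => EFin \o g n) (EFin \o h) (EFin \o cst M).
  - move=> n; apply: (measurable_int P); exact: integrable_step_approx.
  - exact/measurable_EFinP.
  - apply: aeW => x _; apply: cvg_EFin; first by apply: nearW.
    apply/cvgrPdist_lt => e e0.
    have /cvgrPdist_lt/(_ _ e0)/nbhs_ballP[r /= r0 hr] := ch x.
    near=> n.
    have [|||y gy xy] := @step_approx_near h (u n) (m n) x n.+1%:R^-1 (u_nd n).
    + move=> i; rewrite /u -[i.+1%:R]natr1 mulrDl mul1r opprD addrACA.
      by rewrite subrr add0r addrAC subrr add0r.
    + rewrite /u mul0r addr0 ltrNl (le_lt_trans (ler_norm _))// normrN.
      by near: n; exact: nbhs_infty_gtr.
    + rewrite um (le_trans (ler_norm _))//.
      by near: n; exact: nbhs_infty_ger.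
    + rewrite /= /g gy; apply: hr; apply: le_lt_trans xy _.
      by near: n; exact: near_infty_natSinv_lt (PosNum r0).
  - exact: finite_measure_integrable_cst.
  - by apply: aeW => x n _; rewrite lee_fin step_approx_bound//; exact: u_nd.
have cvgD : `|\int[mu]_x g n x - \int[nu]_x g n x| @[n --> \oo] -->
    `|\int[mu]_x h x - \int[nu]_x h x|.
  by apply: cvg_norm; apply: cvgB; exact: cvgI.
(* The bound is uniform in [n] and defines a closed half-line, so it passes to the limit. *)
apply: (closed_cvg (fun y => y <= V * c) _ _ _ cvgD); first exact: closed_le.
apply: nearW => n.
apply: le_trans (Rintegral_step_approx_diff mu nu h (u n) (m n) c munu) _.
rewrite ler_wpM2r// -lee_fin.
apply: le_trans (sum_increments_le_variation h (u n) (m n) (u_nd n)) _.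
apply: le_trans hV; apply: ereal_sup_ubound => /=.
by exists (u n 0%N, u n (m n)) => //=; exact: u_nd.
Unshelve. all: by end_near. Qed.

End step_approximation.


(** * Supports of measures, and laws determined by their distribution functions *)

Section msupport.
Context {R : realType} (mu : {measure set R -> \bar R}).

(** A point outside the support has an open neighbourhood of measure zero, and this neighbourhood
    serves all of its own points, so the complement is open. *)
Lemma closed_msupport : closed (msupport mu).
Proof.
rewrite -[msupport mu]setCK closedC openE => x /existsNP[U /not_implyP[oU]].
move=> /not_implyP[Ux muU]; apply: filterS (open_nbhs_nbhs (conj oU Ux)).
by move=> y Uy /(_ U oU Uy).
Qed.

Lemma measurable_msupport : measurable (msupport mu).
Proof. exact: closed_measurable closed_msupport. Qed.

(** The line is second countable: every point outside the support lies in a null interval with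
    rational endpoints, and there are countably many of these. *)
Lemma msupportC_null : mu (~` msupport mu) = 0%E.
Proof.
(* An enumeration of the null rational intervals; the empty set stands in for intervals of positive
   measure and for numbers that encode no pair. *)
pose F n : set R := if @unpickle (rat * rat)%type n is Some q then
  (if mu [set` `]ratr q.1, ratr q.2[] == 0%E then [set` `]ratr q.1, ratr q.2[]
   else set0) else set0.
have mF n : measurable (F n).
  by rewrite /F; case: unpickle => // -[p q]; case: ifP.
have FE q : mu [set` `]ratr q.1, ratr q.2[] = 0%E ->
    F (pickle q) = [set` `]ratr q.1, ratr q.2[].
  by move=> q0; rewrite /F pickleK q0 eqxx.
have F0 n : mu (F n) = 0%E.
  by rewrite /F; case: unpickle => // -[p q]; case: ifP => // /eqP.
have mUF : measurable (\bigcup_n F n) by exact: bigcup_measurable.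
apply: (@subset_measure0 _ _ _ mu _ (\bigcup_n F n)) => //.
- exact: measurableC measurable_msupport.
- move=> x /existsNP[U /not_implyP[oU /not_implyP[Ux /negP]]].
  rewrite -leNgt => muU.
  have /nbhs_ballP[e /= e0 xeU] := open_nbhs_nbhs (conj oU Ux).
  have [p xp] := @rat_in_itvoo R (x - e) x ltac:(lra).
  have [q xq] := @rat_in_itvoo R x (x + e) ltac:(lra).
  move: xp xq; rewrite !in_itv/= => /andP[xp px] /andP[xq qx].
  pose pq : rat * rat := (p, q).
  exists (pickle pq); first exact: I.
  rewrite FE; first by rewrite /pq /= in_itv/= px xq.
  apply/eqP.
  rewrite eq_le measure_ge0 andbT (le_trans _ muU)// le_measure ?inE//.
    exact: open_measurable.
  move=> y /=; rewrite in_itv/= => /andP[py yq].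
  by apply: xeU; rewrite /ball/= ltr_distlC; apply/andP; split; lra.
- apply/negligibleP => //; apply: negligible_bigcup => n.
  by apply/negligibleP; [exact: mF|exact: F0].
Qed.

End msupport.

(** The intervals ]a, c] generate the Borel sets and are stable under intersection, and the measure
    of ]a, c] is a difference of two values of the distribution function. *)
Lemma eq_probability_cdf {R : realType} (mu nu : probability R R) :
  (forall x, mu [set` `]-oo, x]] = nu [set` `]-oo, x]]) ->
  forall A, measurable A -> mu A = nu A.
Proof.
move=> munu A mA.
apply: (measure_unique (@ocitv R) (fun n => [set` `]- n%:R, n%:R]])) => //.
- exact: ocitvI.
- by move=> n; exact: is_ocitv.
- apply/seteqP; split=> // x _; exists (Num.truncn `|x|).+1 => //=.
  by have := truncnS_gt `|x|; rewrite in_itv/= ltr_norml => /andP[-> /ltW].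
- move=> _ [[a c] _ <-] /=; have [ac|ca] := leP a c; last first.
    by rewrite set_itv_ge ?measure0// bnd_simp -leNgt ltW.
  have -> : [set` `]a, c]] = [set` `]-oo, c]] `\` [set` `]-oo, a]].
    by rewrite -[RHS]setCK setCD setCitvl setUC -[LHS]setCK setCitv.
  have ca : [set` `]-oo, a]] `<=` [set` `]-oo, c]] by exact: subset_itvl.
  rewrite !measureD ?setIidr//; last first.
  + by rewrite -ge0_fin_numE// fin_num_measure.
  + by rewrite -ge0_fin_numE// fin_num_measure.
  by congr (_ - _)%E; exact: munu.
- by move=> n; rewrite -ge0_fin_numE// fin_num_measure.
Qed.

(** * Conditioning on the value of the treatment *)

Section kernel_slice.
Context {d1 d2 d3} {T1 : measurableType d1} {T2 : measurableType d2}
  {T3 : measurableType d3} {R : realType}.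
Variables (F : R.-pker (T1 * T2) ~> T3) (t : T2).

(** Registered below as a subprobability for each [x], so that it is a point of [giry] and the bind
    of the Giry monad applies to it. *)
Definition kernel_slice (x : T1) : set T3 -> \bar R := F (x, t).

HB.instance Definition _ x := Measure.copy (kernel_slice x) (F (x, t)).

Let kernel_slice_setT x : (kernel_slice x [set: T3] <= 1)%E.
Proof. by rewrite /kernel_slice prob_kernel. Qed.

HB.instance Definition _ x :=
  Measure_isSubProbability.Build _ _ _ (kernel_slice x) (kernel_slice_setT x).

End kernel_slice.

Section conditional_probability.
Context {d : measure_display} {Omega : measurableType d} {R : realType}.
Variables (P : probability Omega R) (X Y : {RV P >-> R}) (D : {RV P >-> bool}).
Variable b : bool.
Local Notation Db := (D @^-1` [set b]).
Hypothesis Db_gt0 : (0 < P Db)%E.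
Local Notation p := (fine (P Db)).

Let mDb : measurable Db := measurable_event D b.

Let p_gt0 : 0 < p.
Proof. by rewrite fine_gt0// Db_gt0/= -ge0_fin_numE// fin_num_measure. Qed.

(** Positivity of the conditioning event excludes the default value of [mnormalize], leaving the
    elementary conditional probability. *)
Lemma cond_probE A : cond_prob D b A = (p^-1%:E * P (A `&` Db))%E.
Proof.
rewrite /cond_prob /= /mnormalize /= {1 2}/mrestr setTI ifF; last first.
  apply/negbTE; rewrite negb_or gt_eqF//= -ltey -ge0_fin_numE//.
  by rewrite fin_num_measure.
by rewrite muleC /mrestr setTI.
Qed.

(** The conditional measure does not charge the complement of the event, and on the event it is [P]
    scaled by [p^-1]. *)
Lemma ge0_integral_cond_prob (phi : Omega -> \bar R) :
  measurable_fun setT phi -> (forall w, (0 <= phi w)%E) ->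
  (\int[cond_prob D b]_w phi w = p^-1%:E * \int[P]_(w in Db) phi w)%E.
Proof.
move=> mphi phi0.
have pV : 0 <= p^-1 by rewrite invr_ge0 ltW.
rewrite (@ge0_negligible_integral _ _ _ _ setT (~` Db))//; last first.
- by rewrite [LHS]cond_probE setICl measure0 mule0.
- exact: measurableC.
rewrite setTD setCK -[p^-1]/(NngNum pV)%:num -ge0_integral_mscale//; last first.
  exact: measurable_funTS.
apply: eq_measure_integral => A mA AD /=.
by rewrite cond_probE (setIidl AD).
Qed.

Lemma integrable_cond_prob (phi : Omega -> \bar R) :
  P.-integrable setT phi -> (cond_prob D b).-integrable setT phi.
Proof.
move=> iphi; have mphi := measurable_int P iphi.
apply/integrableP; split => //.
rewrite ge0_integral_cond_prob//; last exact: measurableT_comp.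
have /integrableP[_ foo] : P.-integrable Db phi.
  exact: (integrableS measurableT).
by rewrite lte_mul_pinfty// lee_fin invr_ge0 ltW.
Qed.

Lemma integral_cond_prob (phi : Omega -> \bar R) : P.-integrable setT phi ->
  (\int[cond_prob D b]_w phi w = p^-1%:E * \int[P]_(w in Db) phi w)%E.
Proof.
move=> iphi; have mphi := measurable_int P iphi.
have iD : P.-integrable Db phi by exact: (integrableS measurableT).
rewrite integralE [in RHS]integralE muleBr//; last first.
  exact: integrable_add_def iD.
rewrite !ge0_integral_cond_prob//.
- exact: measurable_funeneg.
- exact: measurable_funepos.
Qed.

(** Given [D = b], the law of [Y] is the mixture of the kernels [F (x, b)] under the law of [X].
    This mixture is a bind of the Giry monad, so it is enough to compare the two measures on Borel
    sets. *)
Lemma integral_cond_dist (F : R.-pker (R * bool) ~> R) (phi : R -> \bar R) :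
  is_cond_dist X Y D F -> measurable_fun setT phi ->
  (forall y, (0 <= phi y)%E) ->
  (\int[cond_law X D b]_x \int[F (x, b)]_y phi y =
   \int[cond_prob D b]_w phi (Y w))%E.
Proof.
move=> FXD mphi phi0.
pose f (x : R) : giry R R := kernel_slice F b x.
have mFB B : measurable B -> measurable_fun setT (fun x => F (x, b) B).
  move=> mB; apply: (measurableT_comp (measurable_kernel F B mB)).
  exact: measurable_pair2.
have mf : measurable_fun setT f by exact: measurable_giry_codensity.
pose mu : giry R R := cond_law X D b.
transitivity (giry_int (giry_bind mu mf) phi); first by rewrite giry_int_bind.
rewrite -[RHS](@ge0_integral_distribution _ _ _ _ _ (cond_prob D b) Y)//.
apply: eq_measure_integral => B mB _.
transitivity (giry_int (giry_bind mu mf) (EFin \o \1_B)).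
  by rewrite /giry_int integral_indic// setIT.
rewrite giry_int_bind//; last 2 first.
- exact/measurable_EFinP.
- by move=> y; rewrite lee_fin.
rewrite /giry_int/=; under eq_integral do rewrite integral_indic// setIT.
rewrite (@ge0_integral_distribution _ _ _ _ _ (cond_prob D b) X)//; last first.
  exact: mFB.
rewrite ge0_integral_cond_prob//; last first.
  exact: (measurableT_comp (mFB B mB)).
(* The rectangle of all [x] and the single value [b] selects the event [D = b], on which
   [F (X w, D w)] is [F (X w, b)]. *)
have /= := FXD (setT `*` [set b]) B (measurableX measurableT _) mB.
have -> : [set w | True /\ D w = b] = Db by apply/seteqP; split=> w //= [].
move=> FDb; rewrite /distribution /pushforward /= cond_probE setIC -FDb//.
by congr (_ * _)%E; apply: eq_integral => w /set_mem <-.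
Qed.

End conditional_probability.

(** * The Kolmogorov-Smirnov bound *)

Section kolmogorov_smirnov.
Context {R : realType} (mu nu : probability R R).

Lemma Rintegral_conull (S : set R) (h : R -> R) : measurable S ->
  mu (~` S) = 0%E -> mu.-integrable setT (EFin \o h) ->
  \int[mu]_(x in S) h x = \int[mu]_x h x.
Proof.
move=> mS muS ih; rewrite /Rintegral; congr fine.
by rewrite [RHS](@negligible_integral _ _ _ _ _ (~` S))//
  ?setTD ?setCK//; exact: measurableC.
Qed.

Lemma cdf_diffE x : `|mu [set` `]-oo, x]] - nu [set` `]-oo, x]]|%E =
  `|fine (mu [set` `]-oo, x]]) - fine (nu [set` `]-oo, x]])|%:E.
Proof. by rewrite -abse_EFin EFinB !fineK ?fin_num_measure. Qed.

Lemma cKS_ge0 : (0 <= cKS mu nu)%E.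
Proof.
apply: le_trans (ereal_sup_ubound _); last by exists 0 => //.
exact: abse_ge0.
Qed.

(** Distribution functions take values in [0, 1]. Finiteness makes it possible to divide by [cKS]
    when it is positive. *)
Lemma cKS_fin_num : cKS mu nu \is a fin_num.
Proof.
rewrite ge0_fin_numE ?cKS_ge0//.
apply: (@le_lt_trans _ _ 1%E); last exact: ltry.
apply: ge_ereal_sup => _ [x _ <-]; rewrite cdf_diffE lee_fin.
set A := [set` _].
have mA : measurable A by exact: measurable_itv.
have le1 (m : probability R R) : fine (m A) <= 1.
  by rewrite -lee_fin fineK ?fin_num_measure// probability_le1.
have ge0 (m : probability R R) : 0 <= fine (m A) by exact: fine_ge0.
have := (le1 mu, le1 nu, ge0 mu, ge0 nu).
by move=> [[[? ?] ?] ?]; rewrite ler_norml; lra.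
Qed.

End kolmogorov_smirnov.

Lemma line_variation_ge0 {R : realType} (h : R -> R) :
  (0 <= line_variation h)%E.
Proof.
by apply: ereal_sup_ubound; exists (0, 0) => //=; rewrite total_variationxx.
Qed.

Lemma Rintegral_diff_le_KS {R : realType} (mu nu : probability R R)
    (S : set R) (g : R -> R) :
  measurable S -> mu (~` S) = 0%E -> nu (~` S) = 0%E ->
  (`|\int[mu]_(x in S) g x - \int[nu]_(x in S) g x|%:E <=
    mKS S g * cKS mu nu)%E.
Proof.
move=> mS muS nuS.
(* If [cKS = 0], the bound is [0] even when [mKS] is infinite, so [mu = nu] is
   used instead of the variation inequality. *)
have := cKS_ge0 mu nu; rewrite le_eqVlt => /predU1P[c0|c_gt0].
  have munu x : mu [set` `]-oo, x]] = nu [set` `]-oo, x]].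
    rewrite -[LHS]fineK ?fin_num_measure// -[RHS]fineK ?fin_num_measure//.
    congr EFin; apply/eqP.
    rewrite -subr_eq0 -normr_le0 -lee_fin -cdf_diffE [leRHS]c0.
    by apply: ereal_sup_ubound; exists x.
  rewrite -c0 mule0 /Rintegral (eq_measure_integral nu) ?subrr ?normr0//.
  by move=> A mA _; exact: eq_probability_cdf.
have cE := fineK (cKS_fin_num mu nu).
have c_pos : 0 < fine (cKS mu nu) by rewrite -lte_fin cE.
(* Division by the positive finite [cKS] turns the claim into a lower bound for an infimum, to be
   checked for each extension [h]. *)
rewrite -cE -lee_pdivrMr//; apply: le_ereal_inf_tmp => _ [h [ch bh hg] <-].
rewrite lee_pdivrMr//.
(* [h] is continuous and bounded, hence integrable on the whole line, and it agrees with [g] on the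
   conull set [S]. *)
have hgS (m : probability R R) : m (~` S) = 0%E ->
    \int[m]_(x in S) g x = \int[m]_x h x.
  move=> mS0; rewrite -(Rintegral_conull m S)//.
    by apply: eq_Rintegral => x /set_mem /hg.
  apply: measurable_bounded_integrable => //.
    by rewrite -ge0_fin_numE// fin_num_measure.
  exact: continuous_measurable_fun.
rewrite !hgS//; have := line_variation_ge0 h.
(* If [h] has infinite variation, the right side is [+oo] because [cKS] is positive. *)
case Vh : (line_variation h) => [V| |//] _; last by rewrite gt0_mulye// leey.
rewrite -EFinM lee_fin; apply: Rintegral_diff_le_variation => //.
  by rewrite Vh.
move=> x; rewrite -lee_fin cE -cdf_diffE.
by apply: ereal_sup_ubound; exists x.
Qed.

(** * Conditional means and the law of total expectation *)

Section kernel_slice_measurability.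
Context {d1 d2 d3} {T1 : measurableType d1} {T2 : measurableType d2}
  {T3 : measurableType d3} {R : realType}.
Variables (F : R.-pker (T1 * T2) ~> T3) (t : T2).

Lemma measurable_kernel_slice :
  measurable_fun setT (fun x => kernel_slice F t x : giry T3 R).
Proof.
apply: measurable_giry_codensity => // B mB.
apply: (measurableT_comp (measurable_kernel F B mB)).
exact: measurable_pair2.
Qed.

(** A composition of two measurable maps: [x] to its slice in [giry], and a measure to its integral
    of [phi]. *)
Lemma measurable_integral_kernel (phi : T3 -> \bar R) :
  measurable_fun setT phi -> (forall y, (0 <= phi y)%E) ->
  measurable_fun setT (fun x => \int[F (x, t)]_y phi y)%E.
Proof.
move=> mphi phi0.
have mi : measurable_fun setT (fun mu : giry T3 R => giry_int mu phi).
  exact: measurable_giry_int.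
exact: (measurableT_comp mi measurable_kernel_slice).
Qed.

End kernel_slice_measurability.

Section conditional_mean.
Context {d : measure_display} {Omega : measurableType d} {R : realType}.
Variables (P : probability Omega R) (X Y : {RV P >-> R}) (D : {RV P >-> bool}).
Variables (F : R.-pker (R * bool) ~> R) (b : bool) (S : set R).
Hypotheses (Db_gt0 : (0 < P (D @^-1` [set b]))%E) (FXD : is_cond_dist X Y D F).
Hypotheses (mS : measurable S) (GS : cond_law X D b (~` S) = 0%E).
Hypothesis iF : forall x, S x -> (F (x, b)).-integrable setT (fun y => y%:E).
Hypothesis iY : P.-integrable setT (EFin \o Y).

Let mE : measurable_fun setT (EFin : R -> \bar R).
Proof. exact/measurable_EFinP. Qed.

(** The two parts are integrated separately because [integral_cond_dist] concerns nonnegative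
    functions. Both are measurable on the whole line, whereas [cond_mean] is identified with their
    difference on [S] only. *)
Let phip x := (\int[F (x, b)]_y ((EFin : R -> \bar R)^\+ y))%E.
Let phin x := (\int[F (x, b)]_y ((EFin : R -> \bar R)^\- y))%E.

Let iYb : (cond_prob D b).-integrable setT (EFin \o Y).
Proof. exact: integrable_cond_prob. Qed.

Let phipE : (\int[cond_law X D b]_x phip x =
  \int[cond_prob D b]_w ((EFin \o Y)^\+ w))%E.
Proof.
rewrite /phip (integral_cond_dist _ X Y)//; last exact: measurable_funepos.
by rewrite [in RHS]funepos_comp.
Qed.

Let phinE : (\int[cond_law X D b]_x phin x =
  \int[cond_prob D b]_w ((EFin \o Y)^\- w))%E.
Proof.
rewrite /phin (integral_cond_dist _ X Y)//; last exact: measurable_funeneg.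
by rewrite [in RHS]funeneg_comp.
Qed.

Let iphip : (cond_law X D b).-integrable setT phip.
Proof.
apply/integrableP; split.
  by apply: measurable_integral_kernel => //; exact: measurable_funepos.
under eq_integral do rewrite gee0_abs ?integral_ge0//.
by rewrite phipE -ge0_fin_numE ?integral_ge0// integrable_pos_fin_num.
Qed.

Let iphin : (cond_law X D b).-integrable setT phin.
Proof.
apply/integrableP; split.
  by apply: measurable_integral_kernel => //; exact: measurable_funeneg.
under eq_integral do rewrite gee0_abs ?integral_ge0//.
by rewrite phinE -ge0_fin_numE ?integral_ge0// integrable_neg_fin_num.
Qed.

Let cond_meanE x : S x -> (cond_mean F x b)%:E = (phip x - phin x)%E.
Proof.
move=> Sx; have iFx := iF x Sx.
by rewrite /cond_mean /Rintegral fineK ?integrable_fin_num// integralE.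
Qed.

Lemma integrable_cond_mean :
  (cond_law X D b).-integrable S (fun x => (cond_mean F x b)%:E).
Proof.
apply: (eq_integrable mS (phip \- phin)%E).
  by move=> x /set_mem Sx; rewrite cond_meanE.
by apply: integrableB => //; exact: (integrableS measurableT).
Qed.

(** Law of total expectation given [D = b]: since [S] is conull, each part may be integrated over
    the whole line, where it yields the mean of the positive or negative part of [Y]. *)
Lemma Rintegral_cond_mean :
  \int[cond_law X D b]_(x in S) cond_mean F x b = \int[cond_prob D b]_w Y w.
Proof.
rewrite /Rintegral; congr fine.
under eq_integral => x /set_mem Sx do rewrite cond_meanE//.
rewrite integralB//; [|exact: (integrableS measurableT)..].
rewrite [RHS]integralE -phipE -phinE.
have E phi : (cond_law X D b).-integrable setT phi ->
    (\int[cond_law X D b]_(x in S) phi x = \int[cond_law X D b]_x phi x)%E.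
  move=> iphi; rewrite [RHS](@negligible_integral _ _ _ _ _ (~` S))//
    ?setTD ?setCK//; exact: measurableC.
by rewrite !E.
Qed.

End conditional_mean.

(** * Coordinates of the regressor, and positive definite matrices *)

Section regressor_lemmas.
Context {R : realType} {k : nat} (s : R -> 'cV[R]_k).

Definition idx_cst : 'I_(1 + 1 + k) := lshift k (lshift 1 ord0).
Definition idx_treat : 'I_(1 + 1 + k) := lshift k (rshift 1 ord0).

Lemma regressor_cst x b : regressor s x b idx_cst ord0 = 1.
Proof. by rewrite /regressor !col_mxEu mxE. Qed.

Lemma regressor_treat x b : regressor s x b idx_treat ord0 = b%:R.
Proof. by rewrite /regressor col_mxEu col_mxEd mxE. Qed.

Lemma regressor_cov x b j :
  regressor s x b (rshift (1 + 1) j) ord0 = s x j ord0.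
Proof. by rewrite /regressor col_mxEd. Qed.

Lemma sqr_eucl_norm n (v : 'cV[R]_n) : eucl_norm v ^+ 2 = \sum_i v i ord0 ^+ 2.
Proof. by rewrite sqr_sqrtr// sumr_ge0// => i _; exact: sqr_ge0. Qed.

Lemma le_eucl_norm n (v : 'cV[R]_n) i : `|v i ord0| <= eucl_norm v.
Proof.
rewrite -sqrtr_sqr ler_wsqrtr// (bigD1 i)//= lerDl sumr_ge0// => j _.
exact: sqr_ge0.
Qed.

(** The constant regressor contributes 1 to the squared norm, and [1 + t ^+ 2] dominates [|t|]. *)
Lemma le_sqr_eucl_norm_regressor x b j :
  `|s x j ord0| <= eucl_norm (regressor s x b) ^+ 2.
Proof.
rewrite sqr_eucl_norm (bigD1 idx_cst)//=.
rewrite (bigD1 (rshift (1 + 1) j)) ?eq_rlshift//=.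
rewrite regressor_cst regressor_cov.
set r := \sum_(_ | _) _.
have r0 : 0 <= r by apply: sumr_ge0 => i _; exact: sqr_ge0.
set t := s x j ord0; have := sqr_ge0 (t - 1); have := sqr_ge0 (t + 1).
by move=> ? ?; rewrite ler_norml; apply/andP; split; nra.
Qed.

End regressor_lemmas.

Lemma posdefmx_diag_gt0 {R : realType} n (A : 'M[R]_n) i :
  posdefmx A -> 0 < A i i.
Proof.
move=> [_ /(_ (delta_mx i ord0))]; rewrite trmx_delta -rowE -colE !mxE; apply.
by apply/eqP => /matrixP /(_ i ord0)/eqP; rewrite !mxE !eqxx oner_eq0.
Qed.

(** The quadratic form is evaluated at the difference of two distinct unit vectors. *)
Lemma posdefmx_diff_gt0 {R : realType} n (A : 'M[R]_n) i j :
  posdefmx A -> i != j -> 0 < A i i - A j i - (A i j - A j j).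
Proof.
move=> [_ Apos] ij; pose v : 'cV[R]_n := delta_mx i ord0 - delta_mx j ord0.
have vT : v^T = delta_mx ord0 i - delta_mx ord0 j.
  by apply/matrixP => a c; rewrite !mxE ![_ && (a == _)]andbC.
have vAv : (v^T *m A *m v) ord0 ord0 = A i i - A j i - (A i j - A j j).
  by rewrite vT mulmxBr !mulmxBl -!rowE -!colE !mxE.
rewrite -vAv; apply: Apos; apply/eqP => /matrixP /(_ i ord0)/eqP.
by rewrite !mxE !eqxx (negbTE ij) subr0 oner_eq0.
Qed.

Lemma treatment_indic {d} {Omega : measurableType d} {R : realType}
    (D : Omega -> bool) w :
  (D w)%:R = \1_(D @^-1` [set true]) w :> R.
Proof.
rewrite indicE; case Dw : (D w); first by rewrite mem_set.
by rewrite memNset//= Dw.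
Qed.

(** * Consequences of the moment conditions *)

Section regression.
Context {d : measure_display} {Omega : measurableType d} {R : realType}.
Variables (P : probability Omega R) (X Y : {RV P >-> R}) (D : {RV P >-> bool}).
Context {k : nat}.
Variables (s : R -> 'cV[R]_k).
Let Z w := regressor s (X w) (D w).

(** The quadratic form of the second moment matrix at the treatment coordinate is E[D^2] = P(D = 1),
    and at the difference of the constant and treatment coordinates it is E[(1 - D)^2] = P(D =
    0). *)
Lemma treatment_prob_gt0 :
  posdefmx (\matrix_(i, j) fine ('E_P[fun w => ((Z w *m (Z w)^T) i j)%R])%E) ->
  forall b, (0 < P (D @^-1` [set b]))%E.
Proof.
set M := \matrix_(_, _) _ => pdM.
have mD b := measurable_event D b.
have ME i j : M i j = fine ('E_P[fun w => (Z w i ord0 * Z w j ord0)%R])%E.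
  rewrite mxE; congr (fine (expectation _ _)); apply/funext => w.
  rewrite mxE big_ord1. by rewrite [(Z w)^T _ _]mxE.
have E1 : fine ('E_P[\1_(D @^-1` [set true])])%E =
    fine (P (D @^-1` [set true])).
  by rewrite expectation_indic.
have M11 : M idx_treat idx_treat = fine (P (D @^-1` [set true])).
  rewrite ME -E1; congr (fine (expectation _ _)); apply/funext => w.
  by rewrite !regressor_treat -treatment_indic -natrM mulnb andbb.
have M01 : M idx_cst idx_treat = fine (P (D @^-1` [set true])).
  rewrite ME -E1; congr (fine (expectation _ _)); apply/funext => w.
  by rewrite regressor_treat regressor_cst mul1r treatment_indic.
have M10 : M idx_treat idx_cst = fine (P (D @^-1` [set true])).
  rewrite ME -E1; congr (fine (expectation _ _)); apply/funext => w.
  by rewrite regressor_treat regressor_cst mulr1 treatment_indic.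
have M00 : M idx_cst idx_cst = 1.
  rewrite ME (_ : (fun _ => _) = cst 1) ?expectation_cst//.
  by apply/funext => w; rewrite regressor_cst mulr1.
have fp := fin_num_measure P _ (mD true).
case; first by rewrite -(fineK fp) lte_fin -M11; exact: posdefmx_diag_gt0.
have -> : D @^-1` [set false] = ~` (D @^-1` [set true]).
  by apply/seteqP; split=> w /=; case: (D w).
rewrite probability_setC// -(fineK fp) -EFinB lte_fin.
have := posdefmx_diff_gt0 _ _ idx_cst idx_treat pdM.
by rewrite M00 M01 M10 M11 subrr subr0; apply; rewrite eq_lshift.
Qed.

Hypothesis ms : measurable_vec s.

Let mD : measurable_fun setT (fun w => (D w)%:R : R).
Proof.
under eq_fun do rewrite treatment_indic.
by apply: measurable_indic; exact: measurable_event.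
Qed.

Let mZ i : measurable_fun setT (fun w => Z w i ord0).
Proof.
case: (fintype.split_ordP i) => j ->; last first.
  under eq_fun do rewrite regressor_cov.
  exact: (measurableT_comp (ms j)).
case: (fintype.split_ordP j) => m ->; rewrite (ord1 m).
  rewrite (_ : (fun w => _) = cst 1); first exact: measurable_cst.
  by apply/funext => w; exact: regressor_cst.
rewrite (_ : (fun w => _) = (fun w => (D w)%:R)) //.
by apply/funext => w; exact: regressor_treat.
Qed.

Lemma measurable_eucl_norm n (v : Omega -> 'cV[R]_n) :
  (forall i, measurable_fun setT (fun w => v w i ord0)) ->
  measurable_fun setT (fun w => eucl_norm (v w)).
Proof.
move=> mv; have msqrt : measurable_fun setT (@Num.sqrt R).
  by apply: continuous_measurable_fun; exact: sqrt_continuous.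
apply: (measurableT_comp (g := fun w => \sum_i v w i ord0 ^+ 2) msqrt).
by apply: measurable_sum => i; exact: measurable_funX.
Qed.

Lemma integrable_covariate :
  ('E_P[fun w => (eucl_norm (Z w) ^+ 2)%R] < +oo)%E ->
  forall j, P.-integrable setT (fun w => (s (X w) j ord0)%:E).
Proof.
move=> EZ j; apply: (@le_integrable _ _ _ P setT measurableT _
  (fun w => (eucl_norm (Z w) ^+ 2)%:E)).
- by apply/measurable_EFinP; exact: (measurableT_comp (ms j)).
- move=> w _; rewrite /= lee_fin [leRHS]ger0_norm ?sqr_ge0//.
  exact: le_sqr_eucl_norm_regressor.
- apply/integrableP; split.
    apply/measurable_EFinP; apply: measurable_funX.
    exact: measurable_eucl_norm.
  under eq_integral do rewrite gee0_abs ?lee_fin ?sqr_ge0//.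
  by move: EZ; rewrite unlock.
Qed.

(** The constant coordinate of [E w *: Z w] is [E w] itself, so the norm of this vector dominates
    the residual. *)
Lemma integrable_residual (E : Omega -> R) : measurable_fun setT E ->
  ('E_P[fun w => (eucl_norm (E w *: Z w))%R] < +oo)%E ->
  P.-integrable setT (EFin \o E).
Proof.
move=> mE EEZ; apply: (@le_integrable _ _ _ P setT measurableT _
  (fun w => (eucl_norm (E w *: Z w))%:E)).
- exact/measurable_EFinP.
- move=> w _; rewrite /= lee_fin [leRHS]ger0_norm ?sqrtr_ge0//.
  apply: le_trans (le_eucl_norm _ _ idx_cst).
  by rewrite mxE regressor_cst mulr1.
- apply/integrableP; split.
    apply/measurable_EFinP; apply: measurable_eucl_norm => i.
    by under eq_fun do rewrite mxE; exact: measurable_funM.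
  under eq_integral do rewrite gee0_abs ?lee_fin ?sqrtr_ge0//.
  by move: EEZ; rewrite unlock.
Qed.

(** Orthogonality to [D] says that the integral of [E] over [D = 1] is zero. Subtracting it from the
    full integral, zero by orthogonality to the constant, settles [D = 0]. *)
Lemma Rintegral_cond_residual (E : Omega -> R) (b : bool) :
  (0 < P (D @^-1` [set b]))%E ->
  P.-integrable setT (EFin \o E) ->
  (forall i, 'E_P[fun w => ((E w *: Z w) i ord0)%R] = 0)%E ->
  \int[cond_prob D b]_w E w = 0.
Proof.
move=> Db_gt0 iE EZ0.
have mDt b' := measurable_event D b'.
rewrite /Rintegral integral_cond_prob//.
suff -> : (\int[P]_(w in D @^-1` [set b]) (E w)%:E = 0)%E by rewrite mule0.
have Et : (\int[P]_(w in D @^-1` [set true]) (E w)%:E = 0)%E.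
  rewrite integral_mkcond -[RHS](EZ0 idx_treat) unlock.
  apply: eq_integral => w _.
  rewrite mxE regressor_treat /patch; case Dw : (D w).
    by rewrite mem_set//= mulr1.
  by rewrite memNset/= ?Dw// mulr0.
case: b Db_gt0 => // _.
have <- : (\int[P]_w (E w)%:E = 0)%E.
  rewrite -(EZ0 idx_cst) unlock; apply: eq_integral => w _.
  by rewrite mxE regressor_cst mulr1.
have -> : [set: Omega] = D @^-1` [set true] `|` D @^-1` [set false].
  by apply/seteqP; split=> w //= _; case: (D w); [left|right].
rewrite integral_setU ?Et ?add0e//.
- exact: measurable_funTS (measurable_int P iE).
- by apply/disj_setPS => w /= [->].
Qed.

End regression.

(** * The bound on the distance between the regression coefficient and the parameter *)

Theorem corollary1 (R : realType) (disp : measure_display)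
  (Omega : measurableType disp) (P : probability Omega R)
  (Y X : {RV P >-> R}) (D : {RV P >-> bool})
  (F : R.-pker (R * bool) ~> R) (k : nat) (s : R -> 'cV[R]_k)
  (alpha beta : R) (gamma : 'cV[R]_k) (E : Omega -> R) :
  let G (d : bool) := cond_law X D d in
  let S := msupport (G false) `|` msupport (G true) in
  let f := cond_mean F in
  let l := lin_reg s alpha beta gamma in
  let Z (w : Omega) := regressor s (X w) (D w) in
  let tau := fine ('E_(cond_prob D true)[Y])%E - \int[G true]_(x in S) f x false in
  is_cond_dist X Y D F ->
  (forall x, S x -> (F (x, false)).-integrable [set: R] (fun y => y%:E)) ->
  (G true).-integrable S (fun x => (f x false)%:E) ->
  measurable_vec s ->
  (forall w, Y w = l (X w) (D w) + E w) ->
  ('E_P[fun w => (eucl_norm (Z w) ^+ 2)%R] < +oo)%E ->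
  ('E_P[fun w => (eucl_norm (E w *: Z w))%R] < +oo)%E ->
  posdefmx (\matrix_(i, j) fine ('E_P[fun w => ((Z w *m (Z w)^T) i j)%R])%E) ->
  (forall i, 'E_P[fun w => ((E w *: Z w) i ord0)%R] = 0)%E ->
  {within S, continuous (fun x => f x false - l x false)} ->
  [bounded f x false - l x false | x in S] ->
  (`|beta - tau|%:E
    <= mKS S (fun x => (f x false - l x false)%R) * cKS (G true) (G false))%E.
Proof.
move=> G S f l Z tau FXD iF if1 ms YE EZ EEZ pdM EZ0 _ _.
have Db_gt0 b : (0 < P (D @^-1` [set b]))%E := treatment_prob_gt0 P X D s pdM b.
pose q x : R := ((s x)^T *m gamma) ord0 ord0.
have lE x b : l x b = alpha + beta * b%:R + q x by [].
have qE x : q x = \sum_j s x j ord0 * gamma j ord0.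
  by rewrite /q mxE; apply: eq_bigr => j _; rewrite mxE.
have mq : measurable_fun setT q.
  rewrite (_ : q = fun x => \sum_j s x j ord0 * gamma j ord0); last first.
    exact/funext/qE.
  by apply: measurable_sum => j; apply: measurable_funM => //; exact: ms.
have icst (c : R) : P.-integrable setT (EFin \o cst c).
  exact: finite_measure_integrable_cst.
have iq : P.-integrable setT (EFin \o (q \o X)).
  rewrite (_ : _ \o _ =
    fun w => (\sum_j (s (X w) j ord0)%:E * (gamma j ord0)%:E)%E).
    apply: integrable_sum => // j _; apply: integrableZr => //.
    exact: integrable_covariate EZ j.
  apply/funext => w; rewrite /= qE -sumEFin.
  by apply: eq_bigr => j _; rewrite EFinM.
have iD : P.-integrable setT (fun w => ((D w)%:R : R)%:E).
  rewrite (_ : (fun w => _) = EFin \o \1_(D @^-1` [set true])).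
    by apply: integrable_indic => //; exact: measurable_event.
  by apply/funext => w /=; rewrite treatment_indic.
have il : P.-integrable setT (fun w => (l (X w) (D w))%:E).
  have -> : (fun w => (l (X w) (D w))%:E) =
      ((cst alpha%:E \+ (fun w => beta%:E * ((D w)%:R : R)%:E)) \+
       (EFin \o (q \o X)))%E.
    by apply/funext => w /=; rewrite lE !EFinD EFinM.
  apply: integrableD => //; apply: integrableD => //; first exact: icst.
  exact: integrableZl.
(* The residual inherits measurability as the difference of [Y] and the regression function. *)
have mE : measurable_fun setT E.
  rewrite (_ : E = fun w => Y w - l (X w) (D w)); last first.
    by apply/funext => w; rewrite YE addrC addKr.
  apply: measurable_funB => //; apply/measurable_EFinP.
  exact: (measurable_int P il).
have iE := integrable_residual P X D s ms E mE EEZ.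
(* Integrability of [Y] comes from that of the regression function and of the residual. *)
have iY : P.-integrable setT (EFin \o Y).
  have -> : EFin \o Y = ((fun w => (l (X w) (D w))%:E) \+ (EFin \o E))%E.
    by apply/funext => w /=; rewrite YE EFinD.
  exact: integrableD.
have mS : measurable S by apply: measurableU; exact: measurable_msupport.
have GS b : G b (~` S) = 0%E.
  apply: (@subset_measure0 _ _ _ (G b) _ (~` msupport (G b))).
  - exact: measurableC.
  - by apply: measurableC; exact: measurable_msupport.
  - by apply: subsetC => x Gx; case: b Gx => Gx; [right|left].
  - exact: msupportC_null.
(* Under [G false], [f x false] is the conditional mean of [Y] in the arm actually observed, so
   integrability of [Y] carries over. *)
have if0 : (G false).-integrable S (fun x => (f x false)%:E).
  exact: (integrable_cond_mean P X Y D F false S (Db_gt0 false) FXD mS iF iY).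
have fi b : (G b).-integrable S (EFin \o f^~ false) by case: b.
have iqG b : (G b).-integrable setT (EFin \o q).
  apply: integrable_pushforward => //; first exact/measurable_EFinP.
  by apply: integrable_cond_prob.
have ilG b : (G b).-integrable setT (EFin \o l^~ false).
  have -> : EFin \o l^~ false = (cst (alpha + beta * 0)%:E \+ (EFin \o q))%E.
    by apply/funext => x /=; rewrite lE EFinD.
  apply: integrableD => //; last exact: iqG.
  exact: (finite_measure_integrable_cst (G b) (alpha + beta * 0)).
(* Given [D = b], [Y] equals [l (X w) false + beta * b%:R + E w], and the residual has conditional
   mean zero. *)
have lG b : \int[G b]_(x in S) l x false =
    \int[cond_prob D b]_w Y w - beta * b%:R.
  have ilX : P.-integrable setT (fun w => (l (X w) false)%:E).
    have -> : (fun w => (l (X w) false)%:E) =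
        (cst (alpha + beta * 0)%:E \+ (EFin \o (q \o X)))%E.
      by apply/funext => w /=; rewrite lE EFinD.
    by apply: integrableD => //; exact: icst.
  have ilXb : P.-integrable setT (fun w => (l (X w) false + beta * b%:R)%:E).
    by under eq_fun do rewrite EFinD; apply: integrableD => //; exact: icst.
  have -> : \int[cond_prob D b]_w Y w =
      \int[cond_prob D b]_w (l (X w) false + beta * b%:R + E w).
    (* The two integrands are compared only on the event [D = b], so the integrals are first
       restricted to it. *)
    rewrite /Rintegral !integral_cond_prob//; last first.
      by under eq_fun do rewrite EFinD; exact: integrableD.
    congr (fine (_ * _)); apply: eq_integral => w /set_mem /= Dw.
    by rewrite YE !lE Dw mulr0 addr0; congr EFin; ring.
  rewrite RintegralD//; [|exact: integrable_cond_prob..].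
  rewrite (Rintegral_cond_residual P X D s E b (Db_gt0 b) iE EZ0) addr0.
  rewrite RintegralD//; [|apply: integrable_cond_prob => //; exact: icst..].
  rewrite Rintegral_cst// [X in fine X]probability_setT mulr1 addrK.
  rewrite (Rintegral_conull (G b) S)// /Rintegral; congr fine.
  rewrite (@integral_distribution _ _ _ _ _ (cond_prob D b) X)//.
    exact: (measurable_int _ (ilG b)).
  exact: integrable_cond_prob.
have gG b : \int[G b]_(x in S) (f x false - l x false) =
    \int[G b]_(x in S) f x false - \int[cond_prob D b]_w Y w + beta * b%:R.
  rewrite RintegralB//; [|exact: fi|exact: integrableS (ilG b)].
  by rewrite lG; ring.
(* By total expectation the integral of [f x false] under [G false] is the mean of [Y] given
   [D = 0], so the second integral vanishes; the first is [beta - tau]. *)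
have <- : \int[G true]_(x in S) (f x false - l x false) -
    \int[G false]_(x in S) (f x false - l x false) = beta - tau.
  have -> : tau =
      \int[cond_prob D true]_w Y w - \int[G true]_(x in S) f x false.
    by rewrite /tau unlock.
  have fG0 : \int[G false]_(x in S) f x false = \int[cond_prob D false]_w Y w.
    exact: (Rintegral_cond_mean P X Y D F false S).
  by rewrite !gG fG0 /=; ring.
exact: Rintegral_diff_le_KS.
Qed.
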